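(* Let $(X,d)$ be a metric space with $|X|\ge 2$ and let $n$ be an integer with $2\le n\le |X|$. Let $T\colon X\to X$ be a Kannan contraction with constant $\lambda\in[0,\frac1n)$, that is, $d(Tx,Ty)\le\lambda\bigl(d(x,Tx)+d(y,Ty)\bigr)$ for all $x,y\in X$. Then $T$ is an $n$-point Kannan-type mapping.
   Context: $|X|$ denotes the cardinality of $X$. For points $x_1,\dots,x_n$ of a metric space $(X,d)$ put $S(x_1,\dots,x_n)=\sum_{1\le i<j\le n} d(x_i,x_j)$. For an integer $n$ with $2\le n\le |X|$, a mapping $T\colon X\to X$ is called an $n$-point Kannan-type mapping if there exists $\mu\in[0,\frac{n-1}{n})$ such that $S(Tx_1,\dots,Tx_n)\le \mu\sum_{i=1}^n d(x_i,Tx_i)$ for all pairwise distinct points $x_1,\dots,x_n\in X$. *)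

(* Defs.v *)
From mathcomp Require Import all_boot all_order all_algebra.
From mathcomp Require Import all_classical all_reals.
From mathcomp Require Import topology.

Set Implicit Arguments.
Unset Strict Implicit.
Unset Printing Implicit Defensive.

Import Order.TTheory GRing.Theory Num.Theory.

Local Open Scope ring_scope.

Definition pair_dist_sum (R : realType) (X : metricType R) (n : nat)
    (x : 'I_n -> X) : R :=
  \sum_(i < n) \sum_(j < n | (i < j)%N) mdist (x i) (x j).

Definition kannan_contraction (R : realType) (X : metricType R)
    (lambda : R) (T : X -> X) : Prop :=
  forall x y : X,
    mdist (T x) (T y) <= lambda * (mdist x (T x) + mdist y (T y)).

(* Intended for 2 <= n <= |X|, which is to be assumed separately: for n > |X| the
   condition on the points is vacuous. *)
Definition npoint_kannan (R : realType) (X : metricType R)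
    (n : nat) (T : X -> X) : Prop :=
  exists mu : R,
    0 <= mu < (n%:R - 1) / n%:R /\
    forall x : 'I_n -> X, injective x ->
      pair_dist_sum (fun i => T (x i)) <=
        mu * \sum_(i < n) mdist (x i) (T (x i)).

(* Main.v *)
Require Import Defs.
From mathcomp Require Import all_boot all_order all_algebra.
From mathcomp Require Import all_classical all_reals.
From mathcomp Require Import topology.

Import Order.TTheory GRing.Theory Num.Theory.

Local Open Scope classical_set_scope.
Local Open Scope card_scope.
Local Open Scope ring_scope.

(** Sum the Kannan inequality over all pairs [i < j]. Each index lies in exactly [n - 1] of these
    pairs, so each [mdist (x i) (T (x i))] is counted [n - 1] times on the right ([sum_ord_pairD]),
    and the constant becomes [lambda * (n - 1)]. *)

Lemma sum_ord_pairD (V : nmodType) (n : nat) (f : 'I_n -> V) :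
  \sum_(i < n) \sum_(j < n | (i < j)%N) (f i + f j) =
  (\sum_(i < n) f i) *+ n.-1.
Proof.
under eq_bigr do rewrite big_split.
(* Exchanging only the second double sum makes both inner sums constant: [f i] occurs once for each
   [j > i] and once for each [j < i], hence once for each [j != i]. *)
rewrite big_split /= [X in _ + X](exchange_big_dep xpredT) //= -big_split /= -sumrMnl.
apply: eq_bigr => i _.
rewrite -[RHS](_ : \sum_(j < n | j != i) f i = _); last first.
  by rewrite sumr_const cardC1 card_ord.
rewrite [RHS](bigID (fun j : 'I_n => (i < j)%N)) /=.
by congr (_ + _); apply: eq_bigl => j; rewrite -val_eqE /=; case: ltngtP.
Qed.

Theorem proposition2p2 (R : realType) (X : metricType R) (n : nat)
    (T : X -> X) (lambda : R)
    (hX : `I_2 #<= [set: X])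
    (hn2 : (2 <= n)%N)
    (hnX : `I_n #<= [set: X])
    (hlambda : 0 <= lambda < 1 / n%:R)
    (hT : kannan_contraction lambda T) :
  npoint_kannan n T.
Proof.
case/andP: hlambda => l0 ln.
have n1E : n.-1%:R = n%:R - 1 :> R.
  by rewrite -subn1 natrB // (ltn_trans _ hn2).
have n1 : 0 < n%:R - 1 :> R by rewrite subr_gt0 ltr1n.
(* Multiplying [lambda < 1 / n] by [n - 1 > 0] keeps the inequality strict, which is the bound
   required of [mu]. *)
exists (lambda * (n%:R - 1)); split.
  rewrite mulr_ge0 ?(ltW n1) //=.
  by rewrite mulrC ltr_pM2l // -div1r.
move=> x _.
(* The counting identity, read from right to left, spreads the bound over pairs, so that it can be
   checked pair by pair. *)
rewrite -mulrA -n1E mulr_natl -sum_ord_pairD mulr_sumr.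
apply: ler_sum => i _; rewrite mulr_sumr.
by apply: ler_sum => j _; exact: hT.
Qed.
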